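(* There exist absolute constants $C,D>0$ such that the following holds. Let $n=2^\ell$, let $S\subseteq\mathbb{F}_2^u$ have size $m$, and let $\lambda:=m/n$. Let $h:\mathbb{F}_2^u\to\mathbb{F}_2^\ell$ be a uniformly random linear map. Then for every $T>0$ satisfying $T\ge D\lambda n^{1/T}$, \[ \Pr_h[\mathsf M(S,h)\ge T]\le C\left(\frac{\lambda n^{1/T}}{T}\right)^2. \]
   Context: A uniformly random linear map is chosen uniformly among all linear maps $\mathbb{F}_2^u\to\mathbb{F}_2^\ell$. For a linear map $h$ and $S\subseteq\mathbb{F}_2^u$, $\mathsf M(S,h):=\max_{y\in\mathbb{F}_2^\ell}|h^{-1}(y)\cap S|$. *)

(* Defs.v *)
From mathcomp Require Import all_boot all_algebra.
From Stdlib Require Import Reals.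

Set Implicit Arguments.
Unset Strict Implicit.
Unset Printing Implicit Defensive.

(* Linear maps F_2^u -> F_2^l are represented by u x l matrices acting on row
   vectors: h(x) = x *m h.  This is a bijection with the set of linear maps,
   so the uniform distribution on matrices is the uniform distribution on
   linear maps. *)

Definition maxload (u l : nat) (S : {set 'rV['F_2]_u}) (h : 'M['F_2]_(u, l)) : nat :=
  \max_(y : 'rV['F_2]_l) #|[set x in S | mulmx x h == y]|.

Definition prob_maxload_ge (u l : nat) (S : {set 'rV['F_2]_u}) (T : R) : R :=
  (INR #|[set h : 'M['F_2]_(u, l) |
            if Rle_dec T (INR (maxload S h)) then true else false]|
   / INR #|{: 'M['F_2]_(u, l)}|)%R.

(* Main.v *)
Require Import Defs.
From mathcomp Require Import all_boot all_order all_algebra.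
From mathcomp Require Import ring lra Rstruct.

Set Implicit Arguments.
Unset Strict Implicit.
Unset Printing Implicit Defensive.
Import Order.TTheory GRing.Theory Num.Theory.

(* Fix b = 32 n^(1/T) and let e(h) be the mean over the bins y of b^load(y) - 1;
   a bin of load T forces 1 + e(h) >= 32^T. A uniform map to F_2^k is obtained
   from a uniform map to F_2^(k+1) by a quotient by a random nonzero vector v,
   which merges the bins y and y + v and turns e into 2 e + X with X >= 0 and, by
   Cauchy-Schwarz, E X <= e^2. So only this scalar process matters. It starts
   from a map to a huge space, injective with probability close to 1, where
   2^j e is (b - 1) lambda, for j steps to go. While 2^j > T, truncating 2^j e
   at 2^J ~ T keeps its second moment under control, so the square of min(e, 1)
   at j = J has mean O((b lambda / T)^2). In the last J steps the probability of reaching 32^(2^J)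
   from e is O(min(1, e^2)). *)

Local Open Scope ring_scope.

(** * Scalar inequalities for the two phases of the process *)

Section Values.
Variable R : realFieldType.
Implicit Types (F G : R -> R) (e x X : R).

(* If [X] is a nonnegative random variable of mean at most [e ^+ 2], then
   [dominates F G] gives [E F (2 e + X) <= G e]: one quotient step costs [G]. *)
Definition dominates F G := forall e, 0 <= e -> exists p : R * R,
  [/\ 0 <= p.2, forall X, 0 <= X -> F (2 * e + X) <= p.1 + p.2 * X
    & p.1 + p.2 * e ^+ 2 <= G e].

(* Bounds the winning probability from potential [e] when fewer than [log T]
   steps remain; the factor [x] is squared at each step, which beats any loss of
   a constant factor. *)
Definition late_shape e := if e <= 1 then e ^+ 2 else 1 + e.
Definition late x e := Num.min 1 (x * late_shape e).

(* [i] counts the steps before the late phase. The mean of the truncated square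
   grows by a factor [1 + O(2 ^- i)] per step; the prefactor, which increases from 1
   to 7, absorbs the product of these factors. *)
Definition early (i : nat) e :=
  7 / (1 + 6 / 2 ^+ i) * (Num.min (2 ^+ i * e) 1) ^+ 2.

(** Where [2 * e + X > 1], either [X] exceeds 1/2 or [e] exceeds 1/4, so [X] or [e ^+ 2] pays for
    [1 + 2 * e + X]. *)
Lemma late_shape_affine e X : 0 <= e <= 1 -> 0 <= X ->
  late_shape (2 * e + X) <= 24 * e ^+ 2 + 4 * X.
Proof.
move=> /andP[e0 e1] X0; rewrite /late_shape; case: ifPn => [le1|]; first by nra.
rewrite -ltNge => gt1; have [?|?] := lerP e (1 / 4); nra.
Qed.

Lemma late_shape_le e : 0 <= e -> late_shape e <= 1 + e.
Proof. by move=> e0; rewrite /late_shape; case: ifPn => // e1; nra. Qed.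

Lemma dominates_late x : 0 <= x <= 1 / 32 -> dominates (late (x ^+ 2)) (late x).
Proof.
move=> /andP[x0 x1] e e0.
have x2 : 0 <= x ^+ 2 by rewrite exprn_ge0.
have [big|small] := lerP 1 (x * late_shape e).
  exists (1, 0); split=> //= [X _|]; last by rewrite /late min_l ?mul0r ?addr0.
  by rewrite mul0r addr0 /late ge_min lexx.
have -> : late x e = x * late_shape e by rewrite /late min_r // ltW.
have [e1|e1] := lerP e 1.
  (* The cost is [28 * x ^+ 2 * e ^+ 2], at most [x * e ^+ 2] because [x <= 1 / 32]. *)
  exists (x ^+ 2 * (24 * e ^+ 2), x ^+ 2 * 4); split=> /= [|X X0|].
  - by nra.
  - rewrite /late ge_min; apply/orP; right.
    by rewrite -mulrA -mulrDr ler_wpM2l // late_shape_affine ?e0.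
  rewrite /late_shape e1 -mulrA -mulrDr expr2 -mulrA ler_wpM2l //.
  by have := sqr_ge0 e; nra.
move: small; rewrite /late_shape leNgt e1 /= => small.
(* The cost is the square of [x * (1 + e)], a number below 1, hence at most that number. *)
exists (x ^+ 2 * (1 + 2 * e), x ^+ 2); split=> //= [X X0|].
  rewrite /late ge_min; apply/orP; right.
  have := @late_shape_le (2 * e + X); rewrite -mulrDr => H.
  by rewrite ler_wpM2l //; apply: le_trans (H _) _; lra.
have -> : x ^+ 2 * (1 + 2 * e) + x ^+ 2 * e ^+ 2 = (x * (1 + e)) ^+ 2 by ring.
by rewrite expr2 ler_piMr ?(ltW small) // mulr_ge0 //; lra.
Qed.

(** Handover between the phases: at [i = 0] the prefactor is 1 and [e] is truncated at 1. *)
Lemma late_le_early e : 0 <= e -> late (1 / 32) e <= early 0 e.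
Proof.
move=> e0; rewrite /late /early expr0 mul1r.
have -> : 7 / (1 + 6 / 1) = 1 :> R by field.
rewrite !mul1r; have [e1|e1] := lerP e 1; last by rewrite expr1n ge_min lexx.
by rewrite ge_min /late_shape e1; apply/orP; right; have := sqr_ge0 e; lra.
Qed.

Lemma dominates_early i : dominates (early i) (early i.+1).
Proof.
move=> e e0; rewrite /early (exprS _ i).
have s1 : 1 <= 2 ^+ i :> R by rewrite exprn_ege1 // ler1n.
set s := 2 ^+ i in s1 *.
pose t := s^-1; have st : s * t = 1 by rewrite /t mulfV //; lra.
have t0 : 0 < t by rewrite /t invr_gt0; lra.
have t1 : t <= 1 by nra.
pose c := 7 / (1 + 6 * t); pose c' := 7 / (1 + 3 * t).
have cE : c * (1 + 6 * t) = 7 by rewrite /c divfK //; lra.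
have c'E : c' * (1 + 3 * t) = 7 by rewrite /c' divfK //; lra.
have -> : 7 / (1 + 6 / s) = c by [].
have -> : 7 / (1 + 6 / (2 * s)) = c'.
  by rewrite /c' /t; congr (_ / _); field; lra.
have c0 : 0 < c by rewrite /c divr_gt0 //; lra.
have c'0 : 0 < c' by rewrite /c' divr_gt0 //; lra.
(* Amounts to [(1 + 3/4 t)(1 + 3 t) <= 1 + 6 t] for [0 <= t <= 1]: the change of prefactor pays for
   one step. *)
have cc' : c * (1 + 3 / 4 * t) <= c' by nra.
have [big|small] := lerP 1 (2 * s * e).
  exists (c, 0); split=> //= [X X0|]; rewrite mul0r addr0; last first.
    by rewrite expr1n mulr1; nra.
  rewrite ler_piMr ?(ltW c0) // exprn_ile1 ?ge_min ?lexx ?orbT //.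
  by rewrite le_min ler01 andbT; nra.
(* Affine bound on the truncated square: below the cut, [s * X <= 1] linearizes the square of
   [s * X]; above it, with [a = 2 * s * e], use [1 <= a ^+ 2 + (2 * a + 1) * (1 - a)]. In the mean,
   [e < t / 2] yields the factor [1 + 3/4 t]. *)
exists (c * (s ^+ 2 * (4 * e ^+ 2)), c * (s ^+ 2 * (4 * e + t))); split=> /=.
- by rewrite mulr_ge0 ?(ltW c0) // mulr_ge0 ?sqr_ge0 //; lra.
- move=> X X0.
  rewrite -[c * _ * X]mulrA -mulrDr ler_wpM2l ?(ltW c0) //.
  have [h|h] := lerP (s * (2 * e + X)) 1.
    have -> : s ^+ 2 * (4 * e ^+ 2) + s ^+ 2 * (4 * e + t) * X
      = s ^+ 2 * (2 * e + X) ^+ 2 + s * X * (s * t - s * X) by ring.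
    have sX0 : 0 <= s * X by nra.
    have se0 : 0 <= s * e by nra.
    by rewrite exprMn lerDl st mulr_ge0 // subr_ge0; nra.
  have -> : s ^+ 2 * (4 * e ^+ 2) + s ^+ 2 * (4 * e + t) * X
     = (2 * s * e) ^+ 2 + (2 * (2 * s * e) + s * t) * (s * X) by ring.
  have ay : 1 - 2 * s * e <= s * X by lra.
  have a0 : 0 <= 2 * s * e by nra.
  rewrite st expr1n; set a := 2 * s * e in small ay a0 *.
  have : (2 * a + 1) * (1 - a) <= (2 * a + 1) * (s * X) by rewrite ler_wpM2l //; lra.
  by nra.
have -> : c * (s ^+ 2 * (4 * e ^+ 2)) + c * (s ^+ 2 * (4 * e + t)) * e ^+ 2
  = (2 * s * e) ^+ 2 * (c * (1 + e + t / 4)) by field.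
rewrite mulrC ler_wpM2r ?sqr_ge0 //; apply: le_trans cc'.
by rewrite ler_wpM2l ?(ltW c0) //; nra.
Qed.

(** The constant bound serves for non-injective maps, the quadratic one for injective maps, whose
    potential is explicit. *)
Lemma early_le i e : 0 <= e -> early i e <= 7 /\ early i e <= 7 * (2 ^+ i * e) ^+ 2.
Proof.
move=> e0; rewrite /early; have s0 : 0 < 2 ^+ i :> R by rewrite exprn_gt0.
have q0 : 0 <= 6 / 2 ^+ i :> R by rewrite divr_ge0 // ltW.
set c := 7 / _.
have c0 : 0 <= c by rewrite divr_ge0 //; lra.
have c7 : c <= 7 by rewrite /c ler_pdivrMr; lra.
have se0 : 0 <= 2 ^+ i * e by nra.
set a := 2 ^+ i * e in se0 *.
have m0 : 0 <= Num.min a 1 by rewrite le_min se0 ler01.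
have m1 : Num.min a 1 <= 1 by rewrite ge_min lexx orbT.
have m2 : Num.min a 1 <= a by rewrite ge_min lexx.
by split; nra.
Qed.

End Values.

(** * Uniform averages over finite groups *)

Section Averages.
Variable R : realFieldType.

Definition avg (T : finType) (f : T -> R) : R := (\sum_t f t) / #|T|%:R.

Lemma le_avg (T : finType) (f g : T -> R) :
  (forall t, f t <= g t) -> avg f <= avg g.
Proof. by move=> fg; rewrite ler_wpM2r ?invr_ge0 ?ler0n // ler_sum. Qed.

Lemma avg_ge0 (T : finType) (f : T -> R) : (forall t, 0 <= f t) -> 0 <= avg f.
Proof. by move=> f0; rewrite divr_ge0 ?ler0n // sumr_ge0. Qed.

Lemma eq_avg (T : finType) (f g : T -> R) : f =1 g -> avg f = avg g.
Proof. by move=> fg; congr (_ / _); apply: eq_bigr. Qed.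

Lemma avgD (T : finType) (f g : T -> R) :
  avg (fun t => f t + g t) = avg f + avg g.
Proof. by rewrite /avg big_split mulrDl. Qed.

Lemma avgZ (T : finType) (c : R) (f : T -> R) :
  avg (fun t => c * f t) = c * avg f.
Proof. by rewrite /avg -mulr_sumr mulrA. Qed.

Lemma avg_cst (T : finType) (t0 : T) (c : R) : avg (fun _ : T => c) = c.
Proof.
rewrite /avg sumr_const -[c *+ _]mulr_natr mulfK // pnatr_eq0 -lt0n.
by apply/card_gt0P; exists t0.
Qed.

Lemma avg_sum (T I : finType) (P : pred I) (f : I -> T -> R) :
  avg (fun t => \sum_(i | P i) f i t) = \sum_(i | P i) avg (f i).
Proof. by rewrite /avg exchange_big /= mulr_suml. Qed.

(** Translation by [s b] carries the fibre of [f] over [y] into the fibre over [y + b], so all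
    fibres have equal size and [f] preserves uniformity. *)
Lemma avg_surj (A B : finZmodType) (f : A -> B) (s : B -> A) (F : B -> R) :
  (forall a b, f (a + s b) = f a + b) -> avg (fun a => F (f a)) = avg F.
Proof.
move=> fs; have cA : #|A|%:R != 0 :> R.
  by rewrite pnatr_eq0 -lt0n; apply/card_gt0P; exists 0.
have cB : #|B|%:R != 0 :> R.
  by rewrite pnatr_eq0 -lt0n; apply/card_gt0P; exists 0.
suff E : (\sum_a F (f a)) * #|B|%:R = #|A|%:R * \sum_b F b.
  apply: (mulIf cA); apply: (mulIf cB).
  by rewrite /avg divfK // E [RHS]mulrAC divfK // mulrC.
have -> : (\sum_a F (f a)) * #|B|%:R = \sum_(b : B) \sum_a F (f a + b).
  rewrite mulr_natr -sumr_const; apply: eq_bigr => b _.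
  by rewrite (reindex_inj (addIr (s b))); apply: eq_bigr => a _; rewrite fs.
rewrite exchange_big mulr_natl -sumr_const /=; apply: eq_bigr => a _.
by rewrite [RHS](reindex_inj (addrI (f a))).
Qed.

(** Over all [v] the correlations sum to [#|V|] times the squared mean; removing [v = 0] subtracts
    the mean of [g ^+ 2], which is at least the squared mean. *)
Lemma sum_autocorrelation_le (V : finZmodType) (g : V -> R) :
  \sum_(v | v != 0) avg (fun y => g y * g (y + v))
    <= (#|V|%:R - 1) * avg g ^+ 2.
Proof.
set N : R := #|V|%:R.
have N0 : 0 < N by rewrite ltr0n; apply/card_gt0P; exists 0.
have Nn0 : N != 0 by rewrite gt_eqF.
rewrite -avg_sum /avg -/N; set s := \sum_t g t; pose q := \sum_t g t ^+ 2.
have -> : \sum_t \sum_(v | v != 0) g t * g (t + v) = s ^+ 2 - q.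
  apply/eqP; rewrite eq_sym subr_eq eq_sym /q -big_split /= expr2 mulr_suml.
  apply/eqP/eq_bigr => y _; rewrite [s](reindex_inj (addrI y)) mulr_sumr /=.
  by rewrite [RHS](bigD1 0) //= addr0 addrC expr2.
have : 0 <= \sum_t (g t - s / N) ^+ 2 by apply: sumr_ge0 => t _; rewrite sqr_ge0.
have -> : \sum_t (g t - s / N) ^+ 2 = q - s ^+ 2 / N.
  have -> : \sum_t (g t - s / N) ^+ 2
      = \sum_t (g t ^+ 2 + - (2 * s / N) * g t + (s / N) ^+ 2).
    by apply: eq_bigr => t _; ring.
  rewrite !big_split /= sumr_const -mulr_sumr -/s -/q -mulr_natr -/N.
  by field.
move=> H; rewrite ler_pdivrMr //.
have -> : (N - 1) * (s / N) ^+ 2 * N = s ^+ 2 - s ^+ 2 / N by field.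
lra.
Qed.

End Averages.

(** * Quotients by a nonzero vector over F_2 *)

Lemma F2_cases (a : 'F_2) : a = 0 \/ a = 1.
Proof. by case: a => [[|[|//]] lt]; [left|right]; apply/val_inj. Qed.

(** In a basis whose first row spans [v], [P] drops the first coordinate and [Q] puts a zero there;
    over F_2 the line through [v] is just [0] and [v]. *)
Lemma quotient_by_vector k (v : 'rV['F_2]_k.+1) : v != 0 ->
  exists P : 'M['F_2]_(k.+1, k), exists Q : 'M['F_2]_(k, k.+1),
    Q *m P = 1%:M /\ forall y, (y *m P == 0) = (y == 0) || (y == v).
Proof.
move=> v0; pose B : 'M_(1 + k) := row_ebase v.
have Bu : B \in unitmx := row_ebase_unit v.
pose P0 : 'M['F_2]_(1 + k, k) := col_mx (0 : 'M_(1, k)) 1%:M.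
pose Q0 : 'M['F_2]_(k, 1 + k) := row_mx (0 : 'M_(k, 1)) 1%:M.
exists (invmx B *m P0), (Q0 *m B); split.
  by rewrite mulmxA mulmxK // mul_row_col mul0mx add0r mul1mx.
have vP : v *m (invmx B *m P0) = 0.
  have vE : v *m invmx B = col_ebase v *m pid_mx (\rank v).
    by rewrite -{1}(mulmx_ebase v) mulmxK.
  rewrite mulmxA vE -mulmxA rank_rV v0 /=.
  have -> : (pid_mx 1 : 'M['F_2]_(1, k.+1)) = row_mx 1%:M (0 : 'M_(1, k)).
    by rewrite -pid_mx_row.
  by rewrite mul_row_col mul0mx mulmx0 add0r mulmx0.
have ker (y : 'rV['F_2]_(1 + k)) : y *m (invmx B *m P0) = 0 ->
    y = row_mx (lsubmx (y *m invmx B)) (0 : 'M_(1, k)) *m B.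
  rewrite mulmxA; set z := y *m invmx B => zP.
  have -> : 0 = rsubmx z.
    by move: zP; rewrite -{1}[z]hsubmxK mul_row_col mulmx0 mulmx1 add0r.
  by rewrite hsubmxK /z mulmxKV.
move=> y; apply/eqP/orP => [yP|[]/eqP->]; [|by rewrite mul0mx|by []].
have yE := ker y yP; have vE := ker v vP.
have M1 (a : 'M['F_2]_1) : a = 0 \/ a = 1%:M.
  by rewrite [a]mx11_scalar; case: (F2_cases (a 0 0)) => ->; [left|right]; rewrite ?raddf0.
case: (M1 (lsubmx (v *m invmx B))) => va.
  by move: v0; rewrite vE va row_mx0 mul0mx eqxx.
case: (M1 (lsubmx (y *m invmx B))) => ya.
  by left; rewrite yE ya row_mx0 mul0mx.
by right; rewrite yE vE va ya.
Qed.

(** * The potential of a random map, from huge codomains down *)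

Section Potential.
Variables (R : realFieldType) (b : R) (u : nat) (S : {set 'rV['F_2]_u}).
Hypothesis b1 : 1 <= b.

Definition load k (h : 'M['F_2]_(u, k)) (y : 'rV['F_2]_k) :=
  #|[set x in S | x *m h == y]|.
Definition excess k (h : 'M['F_2]_(u, k)) (y : 'rV['F_2]_k) : R := b ^+ load h y - 1.
Definition pot k (h : 'M['F_2]_(u, k)) : R := avg (excess h).

Lemma excess_ge0 k (h : 'M['F_2]_(u, k)) y : 0 <= excess h y.
Proof. by rewrite subr_ge0 exprn_ege1. Qed.

Lemma pot_ge0 k (h : 'M['F_2]_(u, k)) : 0 <= pot h.
Proof. by apply: avg_ge0 => y; apply: excess_ge0. Qed.

Lemma load_quotient k (H : 'M['F_2]_(u, k.+1)) (P : 'M['F_2]_(k.+1, k))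
    (v y : 'rV['F_2]_k.+1) : v != 0 ->
  (forall y, (y *m P == 0) = (y == 0) || (y == v)) ->
  load (H *m P) (y *m P) = (load H y + load H (y + v)%R)%N.
Proof.
move=> v0 kerP; rewrite /load -cardsUI.
have -> : [set x in S | x *m H == y] :&: [set x in S | x *m H == y + v] = set0.
  apply/setP=> x; rewrite !inE; apply/negP => /andP[/andP[_ /eqP->]] /andP[_].
  by rewrite -subr_eq0 opprD addNKr oppr_eq0 (negPf v0).
rewrite cards0 addn0; congr #|pred_of_set _|.
apply/setP=> x; rewrite !inE -andb_orr; congr (_ && _).
by rewrite mulmxA -subr_eq0 -mulmxBl kerP subr_eq0 subr_eq addrC.
Qed.

(** Merging bins of excess [p] and [q] gives [(1 + p)(1 + q) - 1 = p + q + p q]. The mean over the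
    quotient can be taken over [y], and the shift by [v] preserves means, whence [2 * pot H]. *)
Lemma pot_quotient k (H : 'M['F_2]_(u, k.+1)) (P : 'M['F_2]_(k.+1, k))
    (Q : 'M['F_2]_(k, k.+1)) (v : 'rV['F_2]_k.+1) :
  v != 0 -> Q *m P = 1%:M ->
  (forall y, (y *m P == 0) = (y == 0) || (y == v)) ->
  pot (H *m P) =
    2 * pot H + avg (fun y : 'rV['F_2]_k.+1 => excess H y * excess H (y + v)).
Proof.
move=> v0 QP kerP; rewrite /pot.
have -> : avg (excess (H *m P)) =
    avg (fun y : 'rV['F_2]_k.+1 => excess (H *m P) (y *m P)).
  apply/esym/(@avg_surj _ _ _ (mulmxr P) (mulmxr Q)) => y z /=.
  by rewrite mulmxDl -mulmxA QP mulmx1.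
have <- : avg (fun y : 'rV['F_2]_k.+1 => excess H y + excess H (y + v)
      + excess H y * excess H (y + v)) =
    2 * avg (excess H) + avg (fun y : 'rV['F_2]_k.+1 => excess H y * excess H (y + v)).
  rewrite 2!avgD; congr (_ + _).
  rewrite mulr_natl mulr2n; congr (_ + _).
  apply: (@avg_surj R 'rV['F_2]_k.+1 'rV['F_2]_k.+1 (fun y => y + v) id (excess H)).
  by move=> a c; rewrite addrAC.
apply: eq_avg => y /=; rewrite /excess (load_quotient H y v0 kerP) exprD.
by move: (b ^+ _) (b ^+ _) => p q; ring.
Qed.

(** For each fixed nonzero [v] the map [H *m P] is uniform, so the left side is bounded by a mean
    affine in [X H v]; averaging over [v] replaces [X H v] by at most [pot H ^+ 2]. *)
Lemma avg_pot_step k F G : dominates F G ->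
  avg (fun h : 'M['F_2]_(u, k) => F (pot h))
    <= avg (fun h : 'M['F_2]_(u, k.+1) => G (pot h)).
Proof.
move=> dom.
have /fin_all_exists[p Hp] (H : 'M['F_2]_(u, k.+1)) := dom _ (pot_ge0 H).
pose X (H : 'M['F_2]_(u, k.+1)) v :=
  avg (fun y : 'rV['F_2]_k.+1 => excess H y * excess H (y + v)).
have X0 H v : 0 <= X H v by apply: avg_ge0 => y; rewrite mulr_ge0 ?excess_ge0.
set L := avg _; pose V := 'rV['F_2]_k.+1; pose N : R := #|{: V}|%:R - 1.
have step v : v != 0 -> L <= avg (fun H => (p H).1 + (p H).2 * X H v).
  move=> v0; have [P [Q [QP kerP]]] := quotient_by_vector v0.
  have -> : L = avg (fun H : 'M['F_2]_(u, k.+1) => F (pot (H *m P))).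
    apply/esym/(@avg_surj _ _ _ (mulmxr P) (mulmxr Q)) => y z /=.
    by rewrite mulmxDl -mulmxA QP mulmx1.
  apply: le_avg => H; rewrite (pot_quotient H v0 QP kerP).
  by have [_ + _] := Hp H; apply; apply: X0.
have sumN c : \sum_(v : V | v != 0) c = N * c.
  rewrite sumr_const -[c *+ _]mulr_natl /N; congr (_ * _).
  have <- : #|predC1 (0 : V)|.+1 = #|{: V}|.
    by rewrite cardC1 prednK //; apply/card_gt0P; exists 0.
  by rewrite -natr1 addrK.
have N0 : 0 < N.
  rewrite subr_gt0 ltr1n (cardD1 0) (cardD1 (const_mx 1)) !inE.
  have : const_mx 1 <> 0 :> V by move=> /rowP e; have := e 0; rewrite !mxE.
  by move=> /eqP/negPf ->.
rewrite -(ler_pM2l N0) -sumN.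
apply: le_trans (ler_sum _ step) _; rewrite -avg_sum -avgZ; apply: le_avg => H.
have [p20 _ pG] := Hp H.
rewrite big_split /= sumN -mulr_sumr; apply: le_trans (ler_wpM2l (ltW N0) pG).
rewrite mulrDr lerD2l mulrCA ler_wpM2l //.
exact: sum_autocorrelation_le.
Qed.

Lemma avg_pot_late k j x : 0 <= x <= 1 / 32 ->
  avg (fun h : 'M['F_2]_(u, k) => late (x ^+ (2 ^ j)) (pot h))
    <= avg (fun h : 'M['F_2]_(u, k + j) => late x (pot h)).
Proof.
move=> x1; elim: j x x1 => [|j IH] x x1; first by rewrite expr1 addn0.
(* Peel off the quotient from dimension [k + j.+1] to [k + j]; the induction hypothesis is used at
   [x ^+ 2]. *)
rewrite expnS exprM addnS; apply: le_trans (avg_pot_step _ (dominates_late x1)).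
apply: IH; case/andP: x1 => x0 x1; rewrite sqr_ge0; nra.
Qed.

Lemma avg_pot_early k i :
  avg (fun h : 'M['F_2]_(u, k) => early 0 (pot h))
    <= avg (fun h : 'M['F_2]_(u, k + i) => early i (pot h)).
Proof.
elim: i => [|i IH]; first by rewrite addn0.
by rewrite addnS; apply: le_trans IH (avg_pot_step _ (@dominates_early R i)).
Qed.

(** Some coordinate [x 0 i] is 1, and adding [y] to row [i] of [h] shifts [x *m h] by [y]; so
    [x *m h] is uniform. *)
Lemma avg_kills k (x : 'rV['F_2]_u) : x != 0 ->
  avg (fun h : 'M['F_2]_(u, k) => (x *m h == 0)%:R : R) = (2 ^+ k)^-1.
Proof.
move=> /rV0Pn[i xi].
have xi1 : x 0 i = 1 by case: (F2_cases (x 0 i)) xi => ->; rewrite ?eqxx.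
rewrite (@avg_surj R 'M['F_2]_(u, k) 'rV['F_2]_k (mulmx x)
  (fun y => delta_mx i 0 *m y) (fun y => (y == 0)%:R)); last first.
  move=> h y; rewrite mulmxDr mulmxA -[x *m delta_mx _ _]colE.
  by rewrite [col i x]mx11_scalar mxE xi1 mul1mx.
rewrite /avg (bigD1 0) //= eqxx big1 => [|y /negPf->//].
by rewrite addr0 card_mx card_Fp // mul1n natrX div1r.
Qed.

Lemma avg_noninjective k :
  avg (fun h : 'M['F_2]_(u, k) => [exists x : 'rV['F_2]_u, (x != 0) && (x *m h == 0)]%:R : R)
    <= 2 ^+ u / 2 ^+ k.
Proof.
apply: (@le_trans _ _ (avg (fun h : 'M['F_2]_(u, k) =>
    \sum_(x : 'rV['F_2]_u | x != 0) (x *m h == 0)%:R))).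
  apply: le_avg => h; case: existsP => [[x /andP[x0 xh]]|_]; last by rewrite sumr_ge0.
  by rewrite (bigD1 x) //= xh lerDl sumr_ge0.
rewrite avg_sum (eq_bigr (fun=> (2 ^+ k)^-1)) => [|x x0]; last exact: avg_kills.
rewrite sumr_const -[_ *+ _]mulr_natl ler_wpM2r ?invr_ge0 ?exprn_ge0 //.
rewrite -natrX ler_nat; apply: leq_trans (max_card _) _.
by rewrite card_mx card_Fp // mul1n.
Qed.

(** All loads are 0 or 1, where the excess is linear in the load, and the loads add up to [#|S|]. *)
Lemma pot_injective k (h : 'M['F_2]_(u, k)) :
  (forall x : 'rV['F_2]_u, x *m h = 0 -> x = 0) -> pot h = (b - 1) * #|S|%:R / 2 ^+ k.
Proof.
move=> inj; have load1 y : (load h y <= 1)%N.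
  apply/card_le1_eqP => x x'; rewrite !inE => /andP[_ /eqP xh] /andP[_ /eqP x'h].
  by apply/eqP; rewrite -subr_eq0; apply/eqP/inj; rewrite mulmxBl xh x'h subrr.
rewrite /pot /avg card_mx card_Fp // mul1n natrX; congr (_ / _).
transitivity (\sum_y (b - 1) * (load h y)%:R).
  by apply: eq_bigr => y _; rewrite /excess; case: (load h y) (load1 y) => [|[]//] _;
    rewrite ?expr0 ?subrr ?mulr0 ?expr1 ?mulr1.
rewrite -mulr_sumr -natr_sum; congr (_ * _%:R).
rewrite -sum1_card (partition_big (fun x => x *m h) xpredT) //=.
by apply: eq_bigr => y _; rewrite /load -sum1_card; apply: eq_bigl => x; rewrite inE.
Qed.

Lemma avg_pot_start k i :
  avg (fun h : 'M['F_2]_(u, k) => early i (pot h))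
    <= 7 * (2 ^+ i * ((b - 1) * #|S|%:R / 2 ^+ k)) ^+ 2 + 7 * (2 ^+ u / 2 ^+ k).
Proof.
set A := 7 * _ ^+ 2.
apply: (@le_trans _ _ (avg (fun h : 'M['F_2]_(u, k) =>
    A + 7 * [exists x : 'rV['F_2]_u, (x != 0) && (x *m h == 0)]%:R))).
  apply: le_avg => h; have [e7 eA] := early_le i (pot_ge0 h).
  case: existsP => [_|inj]; first by rewrite mulr1 ler_wpDl // mulr_ge0 ?sqr_ge0.
  rewrite mulr0 addr0 /A -(pot_injective (h := h)) // => x xh.
  by apply/eqP/negPn/negP => x0; apply: inj; exists x; rewrite x0 xh eqxx.
rewrite avgD avgZ (avg_cst 0) lerD2l ler_wpM2l //; exact: avg_noninjective.
Qed.

End Potential.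

(** * Probability of a heavy bin *)

Lemma exp_load_le_pot (R : realFieldType) (b : R) u S k (h : 'M['F_2]_(u, k)) y :
  1 <= b -> b ^+ load S h y / 2 ^+ k <= 1 + pot b S h.
Proof.
move=> b1; rewrite -[X in X + _](avg_cst (0 : 'rV['F_2]_k)) -avgD.
rewrite /avg card_mx card_Fp // mul1n natrX ler_wpM2r ?invr_ge0 ?exprn_ge0 //.
rewrite (bigD1 y) //= /excess [1 + _]addrC subrK lerDl sumr_ge0 // => z _.
by rewrite addrC subrK exprn_ge0 //; lra.
Qed.

(** Start in dimension [l + J + i], with [i] early steps and then [J] late ones. The main term does
    not depend on [i], and the error from non-injective maps vanishes as [i] grows. *)
Lemma avg_large_load (R : archiRealFieldType) (b : R) u (S : {set 'rV['F_2]_u}) l J :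
  1 <= b ->
  avg (fun h : 'M['F_2]_(u, l) =>
      [exists y, 32 ^+ (2 ^ J) * 2 ^+ l <= b ^+ load S h y]%:R : R)
    <= 7 * ((b - 1) * #|S|%:R / 2 ^+ (l + J)) ^+ 2.
Proof.
move=> b1; set p := avg _; set q := 7 * _.
(* A heavy bin forces [1 + pot b S h >= 32 ^+ (2 ^ J)], where [late] at the inverse of this number
   equals 1. *)
have markov : p <= avg (fun h : 'M['F_2]_(u, l) =>
    late ((1 / 32) ^+ (2 ^ J)) (pot b S h)).
  apply: le_avg => h; have e0 := pot_ge0 S b1 h.
  set x := (1 / 32) ^+ _; have x0 : 0 < x by rewrite exprn_gt0 // divr_gt0 // ltr0n.
  have B32 : 32 <= 32 ^+ (2 ^ J) :> R by rewrite ler_eXnr ?expn_gt0 //; lra.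
  have xB : x * 32 ^+ (2 ^ J) = 1.
    by rewrite /x -exprMn divfK ?pnatr_eq0 // expr1n.
  case: existsP => [[y big]|_]; last first.
    rewrite le_min ler01 mulr_ge0 ?(ltW x0) // /late_shape.
    by case: ifP => _; rewrite ?sqr_ge0 // addr_ge0.
  have := exp_load_le_pot S h y b1.
  rewrite ler_pdivrMr ?exprn_gt0 // => /(le_trans big).
  rewrite ler_pM2r ?exprn_gt0 // => H.
  move: (32 ^+ (2 ^ J)) B32 xB H => B B32 xB H.
  rewrite le_min lexx /late_shape ifF; last first.
    by apply/negbTE; rewrite -ltNge; clear -B32 H; lra.
  by rewrite -[leLHS]xB ler_wpM2l ?(ltW x0).
have bound i : p <= q + 7 * 2 ^+ u / 2 ^+ i.
  apply: le_trans markov _.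
  apply: le_trans (avg_pot_late S b1 _ _ _) _; first by apply/andP; split; lra.
  apply: (@le_trans _ _ (avg (fun h : 'M['F_2]_(u, l + J) => early 0 (pot b S h)))).
    by apply: le_avg => h; apply: late_le_early; apply: pot_ge0.
  apply: le_trans (avg_pot_early S b1 _ i) _.
  apply: le_trans (avg_pot_start S b1 _ i) _; rewrite lerD //.
    rewrite ler_wpM2l // le_eqVlt; apply/orP; left; apply/eqP; congr (_ ^+ 2).
    rewrite (exprD _ (l + J)%N i); field.
    by apply/andP; split; rewrite expf_neq0 // pnatr_eq0.
  rewrite -mulrA ler_wpM2l // ler_wpM2l ?exprn_ge0 // lef_pV2 ?posrE ?exprn_gt0 //.
  by rewrite ler_weXn2l ?leq_addl // ler1n.
rewrite leNgt; apply/negP => qp; have d0 : 0 < p - q by rewrite subr_gt0.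
pose i := Num.bound (7 * 2 ^+ u / (p - q)).
have := @upper_nthrootP _ (7 * 2 ^+ u / (p - q)) i (leqnn _).
rewrite ltr_pdivrMr // => lt; have := bound i.
by rewrite -lerBlDl ler_pdivlMr ?exprn_gt0 // leNgt [(p - q) * _]mulrC lt.
Qed.

(** Take [b = 32 * rho]; then [T < 2 * 2 ^+ J] bounds [(b - 1) / 2 ^+ J] by [64 * rho / T]. *)
Lemma avg_large_load_dyadic (R : archiRealFieldType) u l (S : {set 'rV['F_2]_u}) (rho T : R) J :
  1 <= rho -> 0 < T -> T < 2 * 2 ^+ J ->
  avg (fun h : 'M['F_2]_(u, l) =>
      [exists y, 32 ^+ (2 ^ J) * 2 ^+ l <= (32 * rho) ^+ load S h y]%:R : R)
    <= 7 * (64 * (#|S|%:R / 2 ^+ l * rho / T)) ^+ 2.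
Proof.
move=> rho1 T0 TJ.
have b1 : 1 <= 32 * rho by lra.
apply: le_trans (avg_large_load S l J b1) _; rewrite ler_wpM2l // exprD.
have P0 : 0 < 2 ^+ J :> R by rewrite exprn_gt0.
have N0 : 0 < 2 ^+ l :> R by rewrite exprn_gt0.
have lam0 : 0 <= #|S|%:R / 2 ^+ l :> R by rewrite divr_ge0 // ltW.
set P := 2 ^+ J in TJ P0 *; set N := 2 ^+ l in N0 lam0 *.
have -> : (32 * rho - 1) * #|S|%:R / (N * P) = #|S|%:R / N * ((32 * rho - 1) / P).
  by field; rewrite !gt_eqF.
have -> : 64 * (#|S|%:R / N * rho / T) = #|S|%:R / N * (64 * rho / T).
  by field; rewrite !gt_eqF.
rewrite ler_pXn2r ?nnegrE ?mulr_ge0 ?invr_ge0 ?(ltW P0) ?(ltW T0) //; try lra.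
rewrite ler_wpM2l // ler_pdivrMr // mulrAC ler_pdivlMr //; nra.
Qed.

(* Real powers and the return to the counting probability *)
Local Close Scope ring_scope.
From Stdlib Require Import Reals Lra.

(** At exponent [T] the base on the right gives exactly [32^T n]; monotonicity in the exponent then
    passes to [K] and [L]. *)
Lemma pow_load_ge (n T : R) (K L : nat) :
  (1 <= n)%R -> (0 < T)%R -> (INR K <= T)%R -> (T <= INR L)%R ->
  (pow 32 K * n <= pow (32 * Rpower n (1 / T)) L)%R.
Proof.
move=> n1 T0 KT TL.
have r0 : (0 < Rpower n (1 / T))%R by apply: exp_pos.
have r1 : (1 <= Rpower n (1 / T))%R.
  rewrite -[X in Rle X _](Rpower_O n); last by Lra.lra.
  apply: Rle_Rpower => //; apply/Rlt_le/Rdiv_lt_0_compat; Lra.lra.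
rewrite -!Rpower_pow; [|Lra.lra|Lra.lra].
apply: (Rle_trans _ (Rpower (32 * Rpower n (1 / T)) T)); last first.
  by apply: Rle_Rpower => //; Lra.lra.
rewrite -Rpower_mult_distr //; last by Lra.lra.
rewrite Rpower_mult (_ : (1 / T * T = 1)%R); last by field; Lra.lra.
rewrite Rpower_1; last by Lra.lra.
apply: Rmult_le_compat_r; first by Lra.lra.
by apply: Rle_Rpower => //; Lra.lra.
Qed.

Local Open Scope ring_scope.

Lemma IZR32 : IZR 32 = 32%:R.
Proof. by rewrite IZRposE INRE. Qed.

Lemma dyadic_floor (T : R) : 1 <= T -> exists J, 2 ^+ J <= T < 2 * 2 ^+ J.
Proof.
move=> T1; pose N := Num.truncn T.
have /andP[NT TN] : N%:R <= T < N.+1%:R by apply: truncn_itv; apply: le_trans T1.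
have N0 : leq 1 N by rewrite truncn_gt0.
have /andP[lo hi] := trunc_log_bounds (isT : leq 2 2) N0.
exists (trunc_log 2 N); rewrite -exprS -!natrX; apply/andP; split.
  by apply: le_trans NT; rewrite ler_nat.
by apply: lt_le_trans TN _; rewrite ler_nat.
Qed.

Lemma prob_maxload_le_avg u l (S : {set 'rV['F_2]_u}) (T : R) (Q : pred 'M['F_2]_(u, l)) :
  (forall h, Rle T (INR (maxload S h)) -> Q h) ->
  prob_maxload_ge l S T <= avg (fun h => (Q h)%:R).
Proof.
move=> PQ; rewrite /prob_maxload_ge RdivE !INRE /avg -natr_sum.
rewrite ler_wpM2r ?invr_ge0 ?ler0n // ler_nat -sum1_card big_mkcond /=.
apply: leq_sum => h _; rewrite inE; case: Rle_dec => //= TM; rewrite PQ //.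
Qed.

Lemma maxload_exp_load u l (S : {set 'rV['F_2]_u}) (T : R) J (h : 'M['F_2]_(u, l)) :
  0 < T -> 2 ^+ J <= T -> Rle T (INR (maxload S h)) ->
  [exists y, 32 ^+ (expn 2 J) * 2 ^+ l
     <= (32 * Rpower (2 ^+ l) (1 / T)) ^+ load S h y].
Proof.
move=> T0 JT TM; have V0 : leq 1 #|{: 'rV['F_2]_l}| by apply/card_gt0P; exists 0.
have [y yE] := bigop.eq_bigmax (fun y : 'rV['F_2]_l => #|[set x in S | mulmx x h == y]|) V0.
apply/existsP; exists y; move: TM; rewrite /maxload yE -/(load S h y) => TL.
have n1 : Rle 1 (2 ^+ l : R) by apply/RleP; rewrite exprn_ege1 // ler1n.
have KT : Rle (INR (expn 2 J)) T by apply/RleP; rewrite INRE natrX.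
have /RltP T0' := T0.
have /RleP := pow_load_ge n1 T0' KT TL.
by rewrite !RpowE IZR32.
Qed.

Lemma prob_maxload_ge_le u l (S : {set 'rV['F_2]_u}) (T : R) :
  let lambda := #|S|%:R / 2 ^+ l in
  let rho := Rpower (2 ^+ l) (1 / T) in
  1 <= rho -> 1 <= T ->
  prob_maxload_ge l S T <= 7%:R * (64%:R * (lambda * rho / T)) ^+ 2.
Proof.
move=> lambda rho rho1 T1; have [J /andP[JT TJ]] := dyadic_floor T1.
have T0 : 0 < T by apply: lt_le_trans T1.
apply: le_trans (avg_large_load_dyadic l S rho1 T0 TJ).
by apply: prob_maxload_le_avg => h; apply: maxload_exp_load.
Qed.

Local Close Scope ring_scope.

Theorem theoremC2 :
  exists C D : R, (0 < C)%R /\ (0 < D)%R /\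
    forall (u l : nat) (S : {set 'rV['F_2]_u}) (T : R),
      let n : R := INR (expn 2 l) in
      let lambda : R := (INR #|S| / n)%R in
      (0 < T)%R ->
      (D * lambda * Rpower n (1 / T) <= T)%R ->
      (prob_maxload_ge l S T <= C * (lambda * Rpower n (1 / T) / T) ^ 2)%R.
Proof.
(* The constant [7 * 64 ^ 2] expands the square in [prob_maxload_ge_le]; [D = 1] already forces
   [T >= 1] for nonempty [S]. *)
exists (7 * 64 ^ 2)%R, 1%R; do 2![split; first by Lra.lra].
move=> u l S T n lambda T0; rewrite Rmult_1_l => lamT.
have n1 : (1 <= n)%R.
  by apply: (le_INR 1); apply/ssrnat.leP; rewrite expn_gt0.
have rho0 : (0 < Rpower n (1 / T))%R by apply: exp_pos.
set rho := Rpower n (1 / T) in lamT rho0 *.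
(* An empty [S] allows [T < 1] and is treated apart: the maximal load is 0, below [T], so the event
   is empty. *)
have [S0|S0] := eqVneq #|S| 0.
  rewrite /prob_maxload_ge (_ : [set h | _] = set0).
    rewrite cards0 /Rdiv Rmult_0_l; apply: Rmult_le_pos; first by Lra.lra.
    exact: pow2_ge_0.
  apply/setP => h; rewrite !inE; case: Rle_dec => // TM; exfalso.
  suff M0 : maxload S h = 0 by move: TM; rewrite M0 /=; Lra.lra.
  rewrite /maxload big1 // => y _; apply/eqP; rewrite -leqn0.
  rewrite -[X in leq _ X]S0; apply: subset_leq_card.
  by apply/subsetP => x; rewrite inE => /andP[].
have m1 : (1 <= INR #|S|)%R by apply: (le_INR 1); apply/ssrnat.leP; rewrite lt0n.
(* Below T = 1 the hypothesis fails: n^(1/T) >= n, so lambda n^(1/T) >= |S| >= 1. *)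
have T1 : (1 <= T)%R.
  case: (Rle_dec 1 T) => // /Rnot_le_lt T1.
  have rhon : (n <= rho)%R.
    rewrite -[X in Rle X _](Rpower_1 n); last by Lra.lra.
    apply: Rle_Rpower => //; apply: (Rmult_le_reg_r T) => //.
    by rewrite /Rdiv Rmult_assoc Rinv_l; Lra.lra.
  have : (lambda * n <= lambda * rho)%R.
    by apply: Rmult_le_compat_l => //; apply/Rlt_le/Rdiv_lt_0_compat; Lra.lra.
  have -> : (lambda * n = INR #|S|)%R by rewrite /lambda; field; Lra.lra.
  by Lra.lra.
have rho1 : (1 <= rho)%R.
  rewrite -[X in Rle X _](Rpower_O n); last by Lra.lra.
  by apply: Rle_Rpower => //; apply/Rlt_le/Rdiv_lt_0_compat; Lra.lra.
have nE : n = INR (expn 2 l) by [].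
rewrite INRE natrX in nE; rewrite /rho nE in rho1 *.
have /RleP rho1' := rho1; have /RleP T1' := T1.
have /RleP := prob_maxload_ge_le S rho1' T1'.
by rewrite exprMn mulrA /lambda nE !(IZRposE, INRE, RpowE, RmultE).
Qed.
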